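(* Let $\{P_j\}_{j\in\mathbb{N}_0}$ be an effective system of selfadjoint projections in a Hilbert space $\mathscr{H}$, and set $Q_0=P_0$, $Q_n=P_n(1-P_{n-1})\cdots(1-P_0)$ for $n\ge1$. Then, for all $x\in\mathscr{H}$, $$x=\sum_{j\in\mathbb{N}_0}Q_jx.$$ Moreover, for all $x,y\in\mathscr{H}$, $$\langle x,y\rangle=\sum_{j\in\mathbb{N}_0}\langle Q_jx,Q_jy\rangle,$$ and in particular $$\|x\|^2=\sum_{j\in\mathbb{N}_0}\|Q_jx\|^2.$$
   Context: $\mathbb{N}_0=\{0,1,2,\dots\}$. A selfadjoint projection is an operator $P$ on $\mathscr{H}$ with $P=P^*=P^2$; $1$ denotes the identity operator. The system $\{P_j\}_{j\in\mathbb{N}_0}$ is called effective if $T_n:=(1-P_n)(1-P_{n-1})\cdots(1-P_0)\to0$ in the strong operator topology, i.e. $\lim_{n}\|T_nx\|=0$ for every $x\in\mathscr{H}$. The infinite sums are limits of the partial sums $\sum_{j=0}^n$ (in norm for the vector-valued sum). *)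

(* Defs.v *)
From HB Require Import structures.
From mathcomp Require Import all_boot all_order all_algebra.
From mathcomp Require Import complex.
From mathcomp Require Import all_classical all_reals all_analysis.

Set Implicit Arguments.
Unset Strict Implicit.
Unset Printing Implicit Defensive.

Import Order.TTheory GRing.Theory Num.Theory.
Import numFieldNormedType.Exports.

Local Open Scope classical_set_scope.
Local Open Scope ring_scope.

(* The scalars of a Hilbert space, with their conjugation: the real numbers
   (trivial conjugation) or the complex numbers. *)
Variant real_or_complex : forall K : numFieldType, (K -> K) -> Prop :=
| RealScalars (R : realType) : @real_or_complex R idfun
| ComplexScalars (R : realType) : @real_or_complex R[i] (@Num.conj R[i]).

(* A Hilbert space is a complete normed module over such a K whose norm, a
   K-valued function in this library, is induced by an inner product that is
   linear in its first argument and conjugate-linear in the second. *)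
Definition norm_induced_by (K : numFieldType) (conj : K -> K)
    (H : completeNormedModType K) (dot : {dot H for conj}) : Prop :=
  forall x : H, `|x| ^+ 2 = dot x x.

Section Operators.
Variables (K : numFieldType) (conj : K -> K) (H : completeNormedModType K).

Definition is_adjoint (dot : {dot H for conj}) (A B : H -> H) : Prop :=
  forall x y : H, dot (A x) y = dot x (B y).

Definition selfadjoint_projection (dot : {dot H for conj})
    (P : {linear H -> H}) : Prop :=
  [/\ continuous P, is_adjoint dot P P & P \o P = P :> (H -> H)].

Variable P : nat -> {linear H -> H}.

Fixpoint T (n : nat) : H -> H :=
  if n is m.+1 then (idfun \- P n) \o T m else idfun \- P 0.

Definition Q (n : nat) : H -> H := if n is m.+1 then P n \o T m else P 0.

Definition effective : Prop :=
  forall x : H, (fun n => `|T n x|) @ \oo --> (0 : K).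

End Operators.

(* Main.v *)
Require Import Defs.
From HB Require Import structures.
From mathcomp Require Import all_boot all_order all_algebra.
From mathcomp Require Import complex.
From mathcomp Require Import all_classical all_reals all_analysis.
From mathcomp Require Import ring.

(** With [T_n = (1 - P_n) ... (1 - P_0)] and [T_(-1) = 1], the operators [Q_n = P_n T_(n-1)] are
    the increments of [1 - T_n], so the partial sums of [Q_j x] telescope to
    [x - T_n x] ([sum_QE]), which tends to [x] exactly when [T_n x] tends to 0.

    For the inner products, a selfadjoint projection splits [<u, v>] into
    [<P u, P v> + <(1 - P) u, (1 - P) v>] ([dot_projE]).  Applied to [P_n] at the
    vectors [T_(n-1) x] and [T_(n-1) y], this says that [<Q_n x, Q_n y>] is the
    loss from [<T_(n-1) x, T_(n-1) y>] to [<T_n x, T_n y>]; these also telescope,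
    to [<x, y> - <T_n x, T_n y>] ([sum_dot_QE]).  By the Cauchy-Schwarz inequality
    ([Cauchy_Schwarz]) the remainder is at most [`|T_n x| * `|T_n y|], and
    effectiveness sends it to 0.  The norm identity is the case [y = x]. *)

Set Implicit Arguments.
Unset Strict Implicit.
Unset Printing Implicit Defensive.

Import Order.TTheory GRing.Theory Num.Theory.
Import numFieldNormedType.Exports.

Local Open Scope classical_set_scope.
Local Open Scope ring_scope.

Lemma mul_conj_normE (K : numFieldType) (conj : K -> K) :
  real_or_complex conj -> forall z : K, z * conj z = `|z| ^+ 2.
Proof.
case=> R z /=; last by rewrite normCK.
by rewrite real_normK ?num_real// expr2.
Qed.

Lemma cvg_cstB0 (K : numFieldType) (V : normedModType K) (a : V)
    (u : nat -> V) :
  u @ \oo --> 0 -> (fun n => a - u n) @ \oo --> a.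
Proof.
move=> u0; have := cvgB (cvg_cst a : (fun _ : nat => a) @ \oo --> a) u0.
by rewrite subr0; exact.
Qed.

Section InnerProduct.
Variables (K : numFieldType) (conj : K -> K) (H : completeNormedModType K).
Variable dot : {dot H for conj}.

Lemma dot_conjC (x y : H) : dot x y = conj (dot y x).
Proof. by have := @hermitian_subproof _ _ _ _ dot x y; rewrite expr0 mul1r. Qed.

(** The usual argument: expand the nonnegative squared norm of
    [<y, y> x - <x, y> y], then divide by [<y, y>].  Conjugation is controlled
    through [z * conj z = `|z| ^+ 2], which covers real and complex scalars at
    once. *)
Lemma Cauchy_Schwarz :
  real_or_complex conj -> norm_induced_by dot ->
  forall x y : H, `|dot x y| <= `|x| * `|y|.
Proof.
move=> Kconj norm_dot x y.
have [->|y0] := eqVneq y 0; first by rewrite linear0r !normr0 mulr0.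
have a_gt0 : 0 < dot y y by rewrite -norm_dot exprn_gt0// normr_gt0.
rewrite -(@ler_pXn2r _ 2)// ?nnegrE ?mulr_ge0// exprMn !norm_dot.
rewrite -(mul_conj_normE Kconj) -subr_ge0 -(pmulr_rge0 _ a_gt0).
have := exprn_ge0 2 (normr_ge0 (dot y y *: x - dot x y *: y)).
rewrite norm_dot (linearBl dot) !(linearBr dot) !(linearZl_LR dot).
rewrite !(linearZr_LR dot) /= -(dot_conjC y y).
by rewrite (dot_conjC y x); congr (0 <= _); ring.
Qed.

(** Pythagoras in polarized form: the ranges of [P] and [1 - P] are
    orthogonal. *)
Lemma dot_projE (P : {linear H -> H}) :
  selfadjoint_projection dot P ->
  forall u v : H, dot (P u) (P v) = dot u v - dot (u - P u) (v - P v).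
Proof.
move=> [_ P_adj P_idem] u v.
have PuPv : dot (P u) (P v) = dot (P u) v.
  by rewrite -P_adj -[P (P u)]/((P \o P) u) P_idem.
by rewrite (linearBl dot) !(linearBr dot) /= -(P_adj u v) PuPv; ring.
Qed.

Section Telescoping.
Variable P : nat -> {linear H -> H}.

Lemma sum_QE (x : H) (n : nat) : \sum_(0 <= j < n.+1) Q P j x = x - T P n x.
Proof.
elim: n => [|n IHn]; first by rewrite big_nat1 /= subKr.
by rewrite big_nat_recr//= IHn opprB addrA addrAC.
Qed.

Lemma sum_dot_QE (x y : H) (n : nat) :
  (forall n, selfadjoint_projection dot (P n)) ->
  \sum_(0 <= j < n.+1) dot (Q P j x) (Q P j y)
    = dot x y - dot (T P n x) (T P n y).
Proof.
move=> P_proj; elim: n => [|n IHn]; first by rewrite big_nat1 /= dot_projE.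
by rewrite big_nat_recr//= IHn dot_projE// addrA subrK.
Qed.

End Telescoping.
End InnerProduct.

Theorem corollary3p11 (K : numFieldType) (conj : K -> K)
    (K_real_or_complex : real_or_complex conj)
    (H : completeNormedModType K) (dot : {dot H for conj})
    (norm_dot : norm_induced_by dot)
    (P : nat -> {linear H -> H})
    (P_proj : forall n : nat, selfadjoint_projection dot (P n))
    (P_effective : effective P) :
  [/\ forall x : H, series (fun j => Q P j x) @ \oo --> x,
      forall x y : H,
        series (fun j => dot (Q P j x) (Q P j y)) @ \oo --> dot x y
    & forall x : H,
        series (fun j => `|Q P j x| ^+ 2) @ \oo --> `|x| ^+ 2].
Proof.
have cvg_dot x y :
    series (fun j => dot (Q P j x) (Q P j y)) @ \oo --> dot x y.
  (* The shift aligns indices: [series] stops before [n], while [T P n] already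
     involves [P n]. *)
  rewrite -cvg_shiftS.
  under eq_fun do rewrite /series /= sum_dot_QE//.
  apply: cvg_cstB0.
  apply: norm_cvg0; apply/cvgr0Pnorm_le => e e_gt0.
  have Txy : (fun n => `|T P n x| * `|T P n y|) @ \oo --> (0 : K).
    by rewrite -[0 : K](mulr0 0); apply: cvgM; exact: P_effective.
  near=> n; rewrite normr_id.
  apply: (le_trans (Cauchy_Schwarz K_real_or_complex norm_dot _ _)).
  rewrite -[leLHS]ger0_norm ?mulr_ge0//.
  by near: n; exact: cvgr0_norm_le Txy _ e_gt0.
split=> [x|//|x]; last first.
  rewrite norm_dot; under eq_fun do rewrite norm_dot.
  exact: cvg_dot.
rewrite -cvg_shiftS.
under eq_fun do rewrite /series /= sum_QE.
apply: cvg_cstB0.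
exact: norm_cvg0 (P_effective x).
Unshelve. all: by end_near.
Qed.
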